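(* Let $T$ be an increasing tableau of skew shape and $\{x_i\}$ a nonempty set of inner corners. Then $\mathtt{LIS}(K\mathtt{jdt}_{\{x_i\}}(T))=\mathtt{LIS}(T)$. In particular, any rectification order applied to $T$ results in a tableau of straight shape whose first row has length $\mathtt{LIS}(T)$.
   Context: Increasing tableau of skew shape $\nu/\lambda$: filling by $\{1,\ldots,q\}$, each label used, strictly increasing along rows and down columns. Inner corner: a box $x\in\lambda$ with $\lambda\setminus\{x\}$ a partition. $K\mathtt{jdt}_{\{x_i\}}(T)$: put $\bullet$ in each $x_i$; for $j=1,\ldots,\max T$ in turn, in every edge-connected component with at least two boxes of the set of boxes containing $\bullet$ or $j$, interchange $\bullet$ and $j$; then delete the $\bullet$ boxes. A rectification order is a sequence of such slides (with arbitrary nonempty corner sets) ending at a straight shape. The reading word of $T$ is obtained by reading the rows of $T$ from left to right, starting with the bottom row and moving up; $\mathtt{LIS}(T)$ is the length of the longest strictly increasing subsequence of the reading word of $T$. *)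

(* Defs.v *)
From HB Require Import structures.
From mathcomp Require Import all_boot finmap.

Set Implicit Arguments.
Unset Strict Implicit.
Unset Printing Implicit Defensive.

Local Open Scope fset_scope.
Local Open Scope fmap_scope.

(* A box is (row, column), both counted from 0; rows are counted downwards. *)
Definition box : Type := (nat * nat)%type.

Definition is_partition (s : seq nat) : bool := sorted geq s && (0 \notin s).

Definition young (s : seq nat) : {fset box} :=
  [fset b in [seq (i, j) | i <- iota 0 (size s), j <- iota 0 (nth 0 s i)]].

Definition is_diagram (D : {fset box}) : Prop :=
  exists2 s : seq nat, is_partition s & D = young s.

(* The domain of the map is the set of boxes that are filled. *)
Definition tableau : Type := {fmap box -> nat}.

Record increasing_tableau (nu lam : seq nat) (T : tableau) : Prop :=
  IncreasingTableau {
    outer_partition : is_partition nu;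
    inner_partition : is_partition lam;
    inner_sub_outer : young lam `<=` young nu;
    tableau_shape : domf T = young nu `\` young lam;
    labels_exact : exists q : nat,
      (forall b k, T.[? b] = Some k -> 1 <= k <= q) /\
      (forall k, 1 <= k <= q -> exists b, T.[? b] = Some k);
    rows_increasing : forall i j j' k k',
      T.[? (i, j)] = Some k -> T.[? (i, j')] = Some k' -> j < j' -> k < k';
    columns_increasing : forall i i' j k k',
      T.[? (i, j)] = Some k -> T.[? (i', j)] = Some k' -> i < i' -> k < k'
  }.

Definition inner_corner (lam : {fset box}) (x : box) : Prop :=
  x \in lam /\ is_diagram (lam `\ x).

Definition adjacent (b c : box) : bool :=
  ((b.1 == c.1) && ((b.2 == c.2.+1) || (c.2 == b.2.+1)))
  || ((b.2 == c.2) && ((b.1 == c.1.+1) || (c.1 == b.1.+1))).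

(* The edge-connected component of b in the set of boxes A. *)
Definition component (A : {fset box}) (b : A) : {set A} :=
  [set c : A | connect (fun x y : A => adjacent (val x) (val y)) b c].

Definition in_large_component (A : {fset box}) (b : box) : bool :=
  [exists a : A, (val a == b) && (1 < #|component a|)].

(* Intermediate states of a slide: None is a bullet, Some k is the label k. *)
Definition dotted : Type := {fmap box -> option nat}.

(* Outside X, T.[? b] is Some k for the label k of b, i.e. the state Some k. *)
Definition put_bullets (X : {fset box}) (T : tableau) : dotted :=
  [fmap b : X `|` domf T => if val b \in X then None else T.[? val b]].

Definition bullets_and (j : nat) (S : dotted) : {fset box} :=
  [fset b in domf S |
    (S.[? b] == Some None) || (S.[? b] == Some (Some j))].

Definition switch (S : dotted) (j : nat) : dotted :=
  [fmap b : domf S =>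
    if in_large_component (bullets_and j S) (val b)
    then (if S b is None then Some j else None)
    else S b].

Definition labelled_boxes (S : dotted) : {fset box} :=
  [fset b in domf S | S.[? b] != Some None].

(* The default 0 is never used: every box kept carries a label. *)
Definition delete_bullets (S : dotted) : tableau :=
  [fmap b : labelled_boxes S => odflt 0 (odflt None S.[? val b])].

Definition max_label (T : tableau) : nat := \max_(b : domf T) T b.

Definition Kjdt (X : {fset box}) (T : tableau) : tableau :=
  delete_bullets (foldl switch (put_bullets X T) (iota 1 (max_label T))).

Definition slide_corners (lam X : {fset box}) : Prop :=
  X <> fset0 /\ (forall x, x \in X -> inner_corner lam x).

(* A slide into X turns the inner shape lam into lam minus X; the shape is
   straight once the inner shape is empty. *)
Fixpoint rectification_order (lam : {fset box}) (Xs : seq {fset box}) : Prop :=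
  if Xs is X :: Xs' then
    slide_corners lam X /\ rectification_order (lam `\` X) Xs'
  else lam = fset0.

Definition rectify (Xs : seq {fset box}) (T : tableau) : tableau :=
  foldl (fun U X => Kjdt X U) T Xs.

Definition reading_before (b c : box) : bool :=
  (c.1 < b.1) || ((b.1 == c.1) && (b.2 <= c.2)).

Definition reading_word (T : tableau) : seq nat :=
  pmap (fun b => T.[? b]) (sort reading_before (domf T)).

Definition LIS (T : tableau) : nat :=
  let w := reading_word T in
  \max_(m : (size w).-tuple bool | sorted ltn (mask m w)) size (mask m w).

(* Main.v *)
(* A chain is a sequence of boxes going strictly right and weakly up with
   increasing labels; in an increasing tableau the longest chain has LIS boxes.
   Give the label k the value 2k and, once the labels up to t have been
   processed, give every bullet the value b = 2t + 1. The filling then stays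
   increasing, and processing the next label is a local rule: a bullet takes the
   value b + 1 if it has a neighbour of value b + 1 and b + 2 otherwise, and the
   cells of value b + 1 change symmetrically.

   A chain of the initial tableau is followed through the slide as a low part
   (values < b) and a high part (values > b). Between the last low cell u and
   the first high cell v one allows, besides the usual step, that v lies one row
   below u and strictly to its right, provided that the cell above v carries a
   value at least b. Such pairs of chains keep their length at every step, so
   the final tableau has a chain as long as the initial one. A rotation by 180
   degrees combined with negation of the values reverses the slide, which gives
   the converse. *)

Require Import Defs.
From HB Require Import structures.
From mathcomp Require Import all_boot all_order all_algebra finmap zify.

Set Implicit Arguments.
Unset Strict Implicit.
Unset Printing Implicit Defensive.

Notation cell := (int * int)%type.

(** * Fillings of the integer grid *)

Section Grid.
Local Open Scope ring_scope.
Import Order.TTheory GRing.Theory Num.Theory.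

Definition weakly_se (a c : cell) : bool := (a.1 <= c.1) && (a.2 <= c.2).

Definition convex (D : pred cell) : Prop :=
  forall a b c, D a -> D c -> weakly_se a b -> weakly_se b c -> D b.

Definition increasing_on (D : pred cell) (w : cell -> int) : Prop :=
  forall a c, D a -> D c -> weakly_se a c -> a != c -> w a < w c.

Definition neighbours (c d : cell) : bool :=
  ((c.1 == d.1) && ((c.2 == d.2 + 1) || (d.2 == c.2 + 1)))
  || ((c.2 == d.2) && ((c.1 == d.1 + 1) || (d.1 == c.1 + 1))).

Definition next_to (D : pred cell) (w : cell -> int) (c : cell) (x : int) :=
  exists d, [/\ D d, neighbours c d & w d = x].

(* A bullet carries the value [b], odd, and the label [k] the value [2 k]. *)
Record slide_step (D : pred cell) (w w' : cell -> int) (b : int) : Prop :=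
  SlideStep {
    step_other : forall c, D c -> w c != b -> w c != b + 1 -> w' c = w c;
    step_bullet : forall c, D c -> w c = b ->
      (w' c = b + 1 /\ next_to D w c (b + 1)) \/
      (w' c = b + 2 /\ ~ next_to D w c (b + 1));
    step_label : forall c, D c -> w c = b + 1 ->
      (w' c = b + 2 /\ next_to D w c b) \/
      (w' c = b + 1 /\ ~ next_to D w c b);
    step_gap : forall c, D c -> w c != b + 2
  }.

Definition ne_step (w : cell -> int) (c d : cell) : bool :=
  [&& d.1 <= c.1, c.2 < d.2 & w c < w d].

(** No condition on the values of [u] and [v] is stated, because [low_in] and [high_in] already give
    [w u < b < w v]. *)
Definition junction (D : pred cell) (w : cell -> int) (b : int)
    (l h : seq cell) : Prop :=
  if l is u :: _ then if h is v :: _ then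
    u.2 < v.2 /\ (v.1 <= u.1 \/
      [/\ u.1 = v.1 - 1, D (v.1 - 1, v.2) & b <= w (v.1 - 1, v.2)])
  else True else True.

(* The part of the chain below the bullets is listed from its last cell. *)
Record extended_chain (D : pred cell) (w : cell -> int) (b : int)
    (l h : seq cell) : Prop := ExtendedChain {
  low_in : all (fun c => D c && (w c < b)) l;
  high_in : all (fun c => D c && (b < w c)) h;
  low_chain : sorted (fun c d => ne_step w d c) l;
  high_chain : sorted (ne_step w) h;
  low_high : junction D w b l h
}.

(** * Basic properties of slide steps *)

Lemma neighbours_sym c d : neighbours c d = neighbours d c.
Proof. case: c d => [a b] [c d]; rewrite /neighbours /=; lia. Qed.

(** The neighbour carries the smaller value, so it cannot lie below [c] or to its right. *)
Lemma next_to_label D w b c : increasing_on D w -> D c -> w c = b + 1 ->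
  next_to D w c b ->
  (D (c.1 - 1, c.2) /\ w (c.1 - 1, c.2) = b) \/
  (D (c.1, c.2 - 1) /\ w (c.1, c.2 - 1) = b).
Proof.
move=> inc Dc wc [[d1 d2] [Dd nb wd]].
have {}inc : ~~ weakly_se c (d1, d2).
  apply/negP=> se; have := inc _ _ Dc Dd se; rewrite wc wd.
  case: eqP => [E _|_ /(_ isT)]; last by lia.
  by move: wd; rewrite -E wc; lia.
case: c wc Dc nb inc => c1 c2 wc Dc;
  rewrite /neighbours /weakly_se /= => nb inc.
have [[E1 E2]|[E1 E2]] : (d1 = c1 - 1 /\ d2 = c2) \/ (d1 = c1 /\ d2 = c2 - 1).
- by lia.
- by left; rewrite -E1 -E2.
- by right; rewrite -E1 -E2.
Qed.

Lemma neighbours_neq D w c d : increasing_on D w -> D c -> D d ->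
  neighbours c d -> w c != w d.
Proof.
case: c d => [c1 c2] [d1 d2] inc Dc Dd nb.
have [se|se] : weakly_se (c1, c2) (d1, d2) \/ weakly_se (d1, d2) (c1, c2).
- by move: nb; rewrite /neighbours /weakly_se /=; lia.
- have := inc _ _ Dc Dd se; rewrite xpair_eqE.
  by move: nb; rewrite /neighbours /=; lia.
- have := inc _ _ Dd Dc se; rewrite xpair_eqE.
  by move: nb; rewrite /neighbours /=; lia.
Qed.

(** Let [e] be a first step from [a] towards [c]. By convexity it is in [D]; if it were not [c]
    itself, its value would lie strictly between two consecutive integers. *)
Lemma consecutive_neighbours D w a c : convex D -> increasing_on D w ->
  D a -> D c -> weakly_se a c -> w c = w a + 1 -> neighbours a c.
Proof.
case: a c => [a1 a2] [c1 c2] cvx inc Da Dc se wc.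
pose e := if a1 < c1 then (a1 + 1, a2) else (a1, a2 + 1).
have ne_ac : (a1, a2) != (c1, c2).
  by apply/eqP=> E; move: wc; rewrite E; lia.
have ae : weakly_se (a1, a2) e by rewrite /e /weakly_se; case: ifP => /=; lia.
have ec : weakly_se e (c1, c2).
  move: se ne_ac; rewrite /e /weakly_se xpair_eqE.
  by case: ifP => /=; lia.
have De := cvx _ _ _ Da Dc ae ec.
have ne_ae : (a1, a2) != e by rewrite /e; case: ifP; rewrite xpair_eqE; lia.
have := inc _ _ Da De ae ne_ae.
have [<- _|ne_ec] := eqVneq e (c1, c2).
  by rewrite /e /neighbours; case: ifP => /=; lia.
have := inc _ _ De Dc ec ne_ec; lia.
Qed.

(** The only critical pair is a bullet [b] before a label [b + 1]: such cells are neighbours, so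
    they exchange and become [b + 1] and [b + 2]. In all other pairs the gap at [b + 2] leaves room
    for the changed value. *)
Lemma slide_step_increasing D w w' b : convex D -> increasing_on D w ->
  slide_step D w w' b -> increasing_on D w'.
Proof.
move=> cvx inc [other bullet label gap] a c Da Dc se ne.
have lt_w := inc _ _ Da Dc se ne.
have [wa|wa] := eqVneq (w a) b.
  have [wc|wc] := eqVneq (w c) (b + 1).
    have nb : neighbours a c.
      by apply: consecutive_neighbours cvx inc Da Dc se _; rewrite wc wa.
    case: (bullet _ Da wa) => [[-> _]|[_ []]]; last by exists c.
    case: (label _ Dc wc) => [[-> _]|[_ []]]; first by lia.
    by exists a; rewrite neighbours_sym.
  have := gap _ Dc; rewrite (other _ Dc _ wc); last by lia.
  by case: (bullet _ Da wa) => [[-> _]|[-> _]]; lia.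
have [wa'|wa'] := eqVneq (w a) (b + 1).
  have := gap _ Dc; rewrite (other _ Dc); [|lia|lia].
  by case: (label _ Da wa') => [[-> _]|[-> _]]; lia.
rewrite (other _ Da wa wa').
have [wc|wc] := eqVneq (w c) b.
  by case: (bullet _ Dc wc) => [[-> _]|[-> _]]; lia.
have [wc'|wc'] := eqVneq (w c) (b + 1).
  by case: (label _ Dc wc') => [[-> _]|[-> _]]; lia.
by rewrite (other _ Dc).
Qed.

(** * Reversing a slide: rotation by 180 degrees with negated values *)

Definition opp_cell (c : cell) : cell := (- c.1, - c.2).
Definition rotate_pred (D : pred cell) : pred cell := fun c => D (opp_cell c).
Definition rotate (w : cell -> int) : cell -> int := fun c => - w (opp_cell c).

Lemma opp_cellK : involutive opp_cell.
Proof. by case=> a b; rewrite /opp_cell /= !opprK. Qed.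

Lemma neighbours_opp c d :
  neighbours (opp_cell c) (opp_cell d) = neighbours c d.
Proof. by case: c d => [a b] [c d]; rewrite /neighbours /=; lia. Qed.

Lemma weakly_se_opp c d : weakly_se (opp_cell c) (opp_cell d) = weakly_se d c.
Proof. by case: c d => [a b] [c d]; rewrite /weakly_se /=; lia. Qed.

Lemma rotate_convex D : convex D -> convex (rotate_pred D).
Proof.
move=> cvx a b c Da Dc ab bc.
by apply: cvx Dc Da _ _; rewrite weakly_se_opp.
Qed.

Lemma rotate_increasing D w : increasing_on D w ->
  increasing_on (rotate_pred D) (rotate w).
Proof.
move=> inc a c Da Dc ac ne.
rewrite /rotate ltrN2; apply: inc => //; first by rewrite weakly_se_opp.
by rewrite (inj_eq (inv_inj opp_cellK)) eq_sym.
Qed.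

Lemma next_to_rotate D w c x :
  next_to (rotate_pred D) (rotate w) c x <-> next_to D w (opp_cell c) (- x).
Proof.
split=> -[d [Dd nb wd]]; exists (opp_cell d).
  by split=> //; [rewrite neighbours_opp | rewrite -wd /rotate opprK].
split; first by rewrite /rotate_pred opp_cellK.
  by rewrite -neighbours_opp opp_cellK.
by rewrite /rotate opp_cellK wd opprK.
Qed.

Lemma slide_step_swap D w w' b c d : slide_step D w w' b -> D c -> D d ->
  neighbours c d -> w c = b -> w d = b + 1 -> w' c = b + 1 /\ w' d = b + 2.
Proof.
move=> [_ bullet label _] Dc Dd nb wc wd; split.
  by case: (bullet _ Dc wc) => [[]//|[_ []]]; exists d.
case: (label _ Dd wd) => [[]//|[_ []]]; exists c; split=> //.
by rewrite neighbours_sym.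
Qed.

(** After the step the bullets carry [b + 2] and the value [b] is free, so under negation [b]
    becomes the gap of the reversed step. Cells that exchanged values see each other again; a cell
    that did not exchange cannot have acquired a partner, since neighbours carry distinct values
    both before and after. *)
Lemma slide_step_rotate D w w' b : increasing_on D w -> slide_step D w w' b ->
  slide_step (rotate_pred D) (rotate w') (rotate w) (- (b + 2)).
Proof.
move=> inc st; have [other bullet label gap] := st.
split=> c Dc; rewrite /rotate ?next_to_rotate.
- set d := opp_cell c; move=> w1 w2.
  have [wd|wd] := eqVneq (w d) b; first by case: (bullet d) => // -[]; lia.
  have [wd'|wd'] := eqVneq (w d) (b + 1).
    by case: (label d) => // -[]; lia.
  by rewrite other.
- have: D (opp_cell c) := Dc.
  move: (opp_cell c) => {Dc}c Dc w'c.
  rewrite (_ : - (- (b + 2) + 1) = b + 1); last by lia.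
  have {}w'c : w' c = b + 2 by lia.
  have [wc|wc] := eqVneq (w c) b.
    right; split; first by lia.
    move=> [d [Dd nb wd]]; have := neighbours_neq inc Dc Dd nb.
    have [wd'|wd'] := eqVneq (w d) (b + 1).
      by have := slide_step_swap st Dc Dd nb wc wd'; lia.
    by move=> ne; have := other _ Dd; lia.
  have wc' : w c = b + 1 by have := other _ Dc; have := gap _ Dc; lia.
  left; split; first by lia.
  case: (label _ Dc wc') => [[_ [d [Dd nb wd]]]|]; last by lia.
  exists d; split=> //; rewrite neighbours_sym in nb.
  by have := slide_step_swap st Dd Dc nb wd wc'; lia.
- have: D (opp_cell c) := Dc.
  move: (opp_cell c) => {Dc}c Dc w'c.
  rewrite opprK.
  have {}w'c : w' c = b + 1 by lia.
  have [wc|wc] := eqVneq (w c) b.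
    left; split; first by lia.
    case: (bullet _ Dc wc) => [[_ [d [Dd nb wd]]]|]; last by lia.
    by exists d; split=> //; have := slide_step_swap st Dc Dd nb wc wd; lia.
  have wc' : w c = b + 1 by have := other _ Dc; lia.
  right; split; first by lia.
  move=> [d [Dd nb wd]]; have := neighbours_neq inc Dc Dd nb.
  have [wd'|wd'] := eqVneq (w d) b.
    by rewrite neighbours_sym in nb; have := slide_step_swap st Dd Dc nb; lia.
  by have := gap _ Dd; have := other _ Dd; lia.
- have: D (opp_cell c) := Dc.
  move: (opp_cell c) => {Dc}c Dc.
  have [wc|wc] := eqVneq (w c) b; first by case: (bullet c) => // -[]; lia.
  have [wc'|wc'] := eqVneq (w c) (b + 1); first by case: (label c) => // -[];
    lia.
  by rewrite other //; lia.
Qed.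

(** * Following a pair of chains through one step *)

Lemma low_part_step D w w' b l : slide_step D w w' b ->
  all (fun c => D c && (w c < b)) l -> sorted (fun c d => ne_step w d c) l ->
  all (fun c => D c && (w' c < b)) l /\ sorted (fun c d => ne_step w' d c) l.
Proof.
move=> [other _ _ _] all_l sorted_l.
have eq_w c : c \in l -> w' c = w c.
  by move=> /(allP all_l) /andP [Dc lt_c]; apply: other => //; lia.
split; first by apply/allP=> c cl; rewrite eq_w // (allP all_l).
apply: (sub_in_sorted (P := [in l])) sorted_l; first by move=> c d cl dl;
  rewrite /ne_step !eq_w.
exact/allP.
Qed.

Lemma high_part_step D w w' b h : slide_step D w w' b ->
  all (fun c => D c && (b + 1 < w c)) h -> sorted (ne_step w) h ->
  all (fun c => D c && (b + 2 < w' c)) h /\ sorted (ne_step w') h.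
Proof.
move=> [other _ _ gap] all_h sorted_h.
have eq_w c : c \in h -> w' c = w c.
  by move=> /(allP all_h) /andP [Dc lt_c]; apply: other => //; lia.
split.
  apply/allP=> c ch; rewrite eq_w //; case/andP: (allP all_h _ ch) => Dc.
  by rewrite Dc; have := gap _ Dc; lia.
apply: (sub_in_sorted (P := [in h])) sorted_h; first by move=> c d cl dl;
  rewrite /ne_step !eq_w.
exact/allP.
Qed.

Lemma slide_step_ge D w w' b c : slide_step D w w' b -> D c -> b <= w c ->
  w' c != b + 1 -> b + 2 <= w' c.
Proof.
move=> [other bullet label gap] Dc wc w'c.
have [E|ne] := eqVneq (w c) b.
  by case: (bullet _ Dc E) => -[E' _]; rewrite E' // eqxx in w'c *.
have [E|ne'] := eqVneq (w c) (b + 1).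
  by case: (label _ Dc E) => -[E' _]; rewrite E' // eqxx in w'c *.
rewrite other //; move: (w c) (gap _ Dc) wc ne ne' => x; clear; lia.
Qed.

(** Values increase along the chain, so only its first cell can carry [b + 1]; the rest is untouched
    by the step. *)
Lemma high_tail D w b v h :
  all (fun c => D c && (b < w c)) (v :: h) -> sorted (ne_step w) (v :: h) ->
  all (fun c => D c && (b + 1 < w c)) h.
Proof.
move=> /= /andP[/andP[_ bv] in_h].
rewrite path_sortedE; last by move=> x y z; rewrite /ne_step; lia.
case/andP=> /allP lt_v _; apply/allP=> c ch.
move: (lt_v _ ch); case/andP: (allP in_h _ ch) => -> _.
by move: bv; rewrite /ne_step; clear; lia.
Qed.

(** The cell [d] replaces the first high cell [v] and becomes the last low cell, which keeps the
    total length. It is meant to be [v] itself, the cell to its left or the cell above it. *)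
Lemma extended_chain_push D w w' b l v h d :
  convex D -> increasing_on D w' ->
  slide_step D w w' b -> extended_chain D w b l (v :: h) ->
  D d -> w' d = b + 1 -> d.2 <= v.2 ->
  v.1 = d.1 \/ (v.1 = d.1 + 1 /\ v.2 = d.2) ->
  (if l is u :: _ then d.1 <= u.1 /\ u.2 < d.2 else True) ->
  extended_chain D w' (b + 2) (d :: l) h.
Proof.
move=> cvx inc' st [in_l in_h ch_l ch_h jn] Dd wd dv2 dv1 ud.
have [in_l' ch_l'] := low_part_step st in_l ch_l.
have in_h2 := high_tail in_h ch_h.
have [in_h' ch_h'] := high_part_step st in_h2 (path_sorted ch_h).
split=> //.
- rewrite /= Dd wd; apply/andP; split; first by lia.
  by apply: sub_all in_l' => c /andP[->]; lia.
- case: l ud in_l' ch_l' {jn in_l ch_l} =>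
    [|u l] //= ud /andP[/andP[_ lt_u] _] ->.
  by rewrite /ne_step wd; lia.
- case: h ch_h in_h' {jn in_h in_h2 ch_h'} =>
    [|v2 h] //= /andP[vv2 _] /andP[/andP[Dv2 lt_v2] _].
  move: vv2; rewrite /ne_step => /and3P[le1 lt2 _].
  split; first by lia.
  have [?|?] := boolP (v2.1 <= d.1); first by left.
  (* Now [d] is above [v], and the next high cell [v2] is in the row of [v]. The cell above [v2]
     lies between [d] and [v2], hence in [D]; it is to the right of [d], so its new value exceeds
     [b + 1] and the relaxed junction holds. *)
  right; have E : v2.1 = d.1 + 1 by lia.
  have E' : v2.1 - 1 = d.1 by lia.
  rewrite E'.
  have De : D (d.1, v2.2).
    by apply: (cvx d _ v2) => //; rewrite /weakly_se /=; lia.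
  split=> //.
  suff: w' d < w' (d.1, v2.2) by lia.
  apply: inc' => //; first by rewrite /weakly_se /=; lia.
  by case: (d) dv2 dv1 E => [d1 d2] /=; rewrite xpair_eqE; lia.
Qed.

(** Only the first high cell [v] and the junction need care. If [v] carries [b + 1], then [v] or a
    bullet exchanged with it passes to the low part; otherwise the chains stay as they are, unless
    the relaxed junction breaks. *)
Lemma extended_chain_step D w w' b l h : convex D -> increasing_on D w ->
  slide_step D w w' b -> extended_chain D w b l h ->
  exists l' h', extended_chain D w' (b + 2) l' h' /\
    (size l' + size h' = size l + size h)%N.
Proof.
move=> cvx inc st ech; have inc' := slide_step_increasing cvx inc st.
have [other bullet label gap] := st.
case: h ech => [|v h] ech.
  case: ech => in_l _ ch_l _ _;
    have [in_l' ch_l'] := low_part_step st in_l ch_l.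
  exists l, [::]; split=> //; split=> //; last by case: (l).
  by apply: sub_all in_l' => c /andP[->]; lia.
have [in_l in_h ch_l ch_h jn] := ech.
have [Dv bv] : D v /\ b < w v by case/andP: in_h => /andP.
have push d : D d -> w' d = b + 1 -> d.2 <= v.2 ->
  v.1 = d.1 \/ (v.1 = d.1 + 1 /\ v.2 = d.2) ->
  (if l is u :: _ then d.1 <= u.1 /\ u.2 < d.2 else True) ->
  exists l' h', extended_chain D w' (b + 2) l' h' /\
    (size l' + size h' = size l + size (v :: h))%N.
  move=> Dd wd dv2 dv1 ud; exists (d :: l), h; split; last by rewrite /=; lia.
  exact: extended_chain_push ech Dd wd dv2 dv1 ud.
have up_v : D (v.1 - 1, v.2) -> w (v.1 - 1, v.2) < w v.
  move=> De; apply: inc => //; first by rewrite /weakly_se /=; lia.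
  by case: (v) => [v1 v2]; rewrite xpair_eqE /=; lia.
have [wv|wv] := eqVneq (w v) (b + 1).
  case: (label _ Dv wv) => [[w'v nt]|[w'v nnt]].
    have nt' := next_to_label inc Dv wv nt.
    (* A bullet above [v] is tried first: it suits both forms of the junction, since [u] is never
       higher than the row of that cell. *)
    have [/andP[Dup /eqP wup]|nup] :=
      boolP (D (v.1 - 1, v.2) && (w (v.1 - 1, v.2) == b)).
      have w'up : w' (v.1 - 1, v.2) = b + 1.
        have nb : neighbours (v.1 - 1, v.2) v by rewrite /neighbours /=; lia.
        by have [] := slide_step_swap st _ Dv nb wup wv.
      apply: (push _ _ w'up) => //=; [by right; lia|].
      by case: (l) jn => [|u l0] //= [uv [?|[-> _ _]]]; lia.
    case: nt' => [[Dup wup]|[Dlf wlf]]; first by rewrite Dup wup eqxx in nup.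
    have [w'lf _] : w' (v.1, v.2 - 1) = b + 1 /\ w' v = b + 2.
      by apply: slide_step_swap st _ Dv _ wlf wv => //;
        rewrite /neighbours /=; lia.
    apply: (push _ _ w'lf) => //=; [by lia|by left|].
    case: (l) jn in_l => [|u l0] //= [uv jn] /andP[/andP[Du lt_u] _].
    (* Without a bullet above [v] the relaxed junction is impossible: the cell above would need a
       value at least [b] and less than [b + 1]. *)
    have vu : v.1 <= u.1.
      case: jn => // -[_ Dup wup]; move: nup; rewrite Dup /=.
      by move: (up_v Dup) wup; rewrite wv; move: (w _) => x; lia.
    split=> //.
    (* The low cell [u] must be strictly left of the bullet: otherwise it would be weakly southeast
       of it and could not have a value below [b]. *)
    have [//|le_vu] := ltP u.2 (v.2 - 1).
    have [E|ne] := eqVneq (v.1, v.2 - 1) u; first by move: wlf; rewrite E; lia.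
    suff: w (v.1, v.2 - 1) < w u by lia.
    by apply: inc ne => //; rewrite /weakly_se /= vu.
  (* Here [v] keeps the value [b + 1], which is now low. A relaxed junction would put a bullet above
     [v], against the absence of bullets next to [v]. *)
  apply: (push v) => //; first by left.
  case: (l) jn in_l => [|u l0] //= [uv jn] /andP[/andP[Du lt_u] _]; split=> //.
  case: jn => // -[_ Dup wup]; case: nnt; exists (v.1 - 1, v.2); split=> //.
    by rewrite /neighbours /=; lia.
  by move: (up_v Dup) wup; rewrite wv; move: (w _) => x; lia.
(* From here [w v] exceeds [b + 1], so [v] stays high. The junction fails only if it is relaxed and
   the cell above [v] ends with [b + 1], below the new bullet value; that cell then replaces [v]. *)
have high : extended_chain D w' (b + 2) l (v :: h) \/
  exists u l0, l = u :: l0 /\ [/\ u.1 = v.1 - 1, u.2 < v.2, D (v.1 - 1, v.2) &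
    w' (v.1 - 1, v.2) = b + 1].
  have [in_l' ch_l'] := low_part_step st in_l ch_l.
  have in_h2 : all (fun c => D c && (b + 1 < w c)) (v :: h).
    rewrite /= Dv (high_tail in_h ch_h) andbT.
    by move: (w v) bv wv => x; clear; lia.
  have [in_h' ch_h'] := high_part_step st in_h2 ch_h.
  have in_l2 : all (fun c => D c && (w' c < b + 2)) l.
    by apply: sub_all in_l' => c /andP[->]; lia.
  case: (l) jn in_l2 ch_l' => [|u l0] /= jn in_l2 ch_l'; first by left.
  case: jn => uv [vu|[E Dup wup]]; first by left; split=> //=; split=> //; left.
  have [w'up|w'up] := eqVneq (w' (v.1 - 1, v.2)) (b + 1).
    by right; exists u, l0.
  left; split=> //=; split=> //; right; split=> //.
  exact: slide_step_ge st Dup wup w'up.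
case: high => [ech'|[u [l0 [El [E uv Dup w'up]]]]]; first by exists l, (v :: h).
apply: (push _ _ w'up) => //=; first by right; lia.
by rewrite El; lia.
Qed.

End Grid.

(** * Sequences of slide steps *)

Section Slides.
Local Open Scope ring_scope.
Import Order.TTheory GRing.Theory Num.Theory.

Lemma slides_increasing D (w_ : nat -> cell -> int) b q :
  convex D -> increasing_on D (w_ 0%N) ->
  (forall t, (t < q)%N -> slide_step D (w_ t) (w_ t.+1) (b + (2 * t)%N%:Z)) ->
  increasing_on D (w_ q).
Proof.
move=> cvx inc; elim: q => // q IH st.
apply: (slide_step_increasing cvx) (st q (ltnSn q)).
by apply: IH => t tq; apply: st; apply: ltnW.
Qed.

Lemma slides_extended_chain D (w_ : nat -> cell -> int) b q s :
  convex D -> increasing_on D (w_ 0%N) ->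
  (forall t, (t < q)%N -> slide_step D (w_ t) (w_ t.+1) (b + (2 * t)%N%:Z)) ->
  all (fun c => D c && (b < w_ 0%N c)) s -> sorted (ne_step (w_ 0%N)) s ->
  exists l h, extended_chain D (w_ q) (b + (2 * q)%N%:Z) l h /\
    (size l + size h = size s)%N.
Proof.
move=> cvx inc st in_s ch_s; elim: q st => [|q IH] st.
  by exists [::], s; split=> //; split=> //; rewrite addr0.
have [|l [h [ech <-]]] := IH; first by move=> t tq; apply: st; apply: ltnW.
have incq : increasing_on D (w_ q).
  by apply: slides_increasing inc _ => // t tq; apply: st; apply: ltnW.
have [l' [h' [ech' sz]]] := extended_chain_step cvx incq (st q (ltnSn q)) ech.
exists l', h'; split=> //.
have -> : (2 * q.+1)%N%:Z = (2 * q)%N%:Z + 2 by clear; lia.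
by rewrite addrA.
Qed.

Lemma slides_chain D (w_ : nat -> cell -> int) b q s :
  convex D -> increasing_on D (w_ 0%N) ->
  (forall t, (t < q)%N -> slide_step D (w_ t) (w_ t.+1) (b + (2 * t)%N%:Z)) ->
  (forall c, D c -> w_ q c <= b + (2 * q)%N%:Z) ->
  all (fun c => D c && (b < w_ 0%N c)) s -> sorted (ne_step (w_ 0%N)) s ->
  exists s', [/\ size s' = size s,
    all (fun c => D c && (w_ q c < b + (2 * q)%N%:Z)) s' &
    sorted (ne_step (w_ q)) s'].
Proof.
move=> cvx inc st top in_s ch_s.
have [l [h [[in_l in_h ch_l _ _] <-]]] :=
  slides_extended_chain cvx inc st in_s ch_s.
(* A high cell would exceed the final bullet value, against [top]; so the whole chain has become
   low. *)
case: h in_h => [_|v h /= /andP[/andP[Dv]]]; last by rewrite ltNge top.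
exists (rev l); split; first by rewrite size_rev addn0.
  by rewrite all_rev.
by rewrite rev_sorted.
Qed.

(** Rotation turns a northeast step into a southwest one and negation reverses the comparison of
    values, so the list has to be reversed. *)
Lemma rotate_chain D w b s :
  all (fun c => D c && (w c < b)) s -> sorted (ne_step w) s ->
  all (fun c => rotate_pred D c && (- b < rotate w c)) (rev (map opp_cell s)) /\
  sorted (ne_step (rotate w)) (rev (map opp_cell s)).
Proof.
move=> in_s ch_s; split.
  rewrite all_rev all_map; apply: sub_all in_s => c /=.
  by rewrite /rotate_pred /rotate opp_cellK ltrN2.
rewrite rev_sorted sorted_map; apply: sub_sorted ch_s => c d.
by rewrite /ne_step /relpre /rotate /= !opp_cellK !ltrN2 lerN2.
Qed.

Lemma slides_chain_backward D (w_ : nat -> cell -> int) b q s :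
  convex D -> increasing_on D (w_ 0%N) ->
  (forall t, (t < q)%N -> slide_step D (w_ t) (w_ t.+1) (b + (2 * t)%N%:Z)) ->
  (forall c, D c -> b <= w_ 0%N c) ->
  all (fun c => D c && (w_ q c < b + (2 * q)%N%:Z)) s ->
  sorted (ne_step (w_ q)) s ->
  exists s', [/\ size s' = size s,
    all (fun c => D c && (b < w_ 0%N c)) s' & sorted (ne_step (w_ 0%N)) s'].
Proof.
move=> cvx inc st bot in_s ch_s.
have [in_r ch_r] := rotate_chain in_s ch_s.
(* The slide is run backwards: the last state comes first, with bullet value [- (b + 2q)], and the
   run ends at [- b]. *)
pose r_ t := rotate (w_ (q - t)%N).
have bq : - (b + (2 * q)%N%:Z) + (2 * q)%N%:Z = - b by rewrite opprD addrNK.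
have := @slides_chain (rotate_pred D) r_ (- (b + (2 * q)%N%:Z)) q
  (rev (map opp_cell s)).
rewrite /r_ subn0 subnn bq => /(_ (rotate_convex cvx)).
case=> //.
- apply: rotate_increasing; exact: slides_increasing cvx inc st.
- move=> t tq; have tq' : (q - t.+1 < q)%N by clear -tq; lia.
  rewrite (_ : q - t = (q - t.+1).+1)%N; last by clear -tq; lia.
  rewrite (_ : - (b + (2 * q)%N%:Z) + (2 * t)%N%:Z =
      - (b + (2 * (q - t.+1))%N%:Z + 2)); last by clear -tq; lia.
  apply: slide_step_rotate (st _ tq').
  apply: slides_increasing inc _ => // t' t'q; apply: st;
    exact: ltn_trans t'q _.
- by move=> c Dc; rewrite /rotate lerN2; apply: bot.
move=> s' [sz in_s' ch_s'].
exists (rev (map opp_cell s')); split.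
- by rewrite size_rev size_map sz size_rev size_map.
- rewrite all_rev all_map; apply: sub_all in_s' => c /=.
  by rewrite /rotate_pred /rotate ltrN2.
- rewrite rev_sorted sorted_map; apply: sub_sorted ch_s' => c d.
  by rewrite /ne_step /relpre /rotate /= !ltrN2 lerN2.
Qed.

End Slides.

(** * From dotted tableaux to fillings of the grid *)

Section Dotted.
Local Open Scope ring_scope.
Import Order.TTheory GRing.Theory Num.Theory.

Definition cell_box (c : cell) : box := (absz c.1, absz c.2).
Definition box_cell (b : box) : cell := (b.1%:Z, b.2%:Z).

(** The sign conditions are needed because [cell_box] takes absolute values and is faithful only on
    the quadrant. *)
Definition cells (A : {fset box}) : pred cell :=
  fun c => [&& 0 <= c.1, 0 <= c.2 & cell_box c \in A].

(** Here [t] counts the labels already processed. The 0 is a placeholder for boxes outside the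
    domain, which [cells (domf S)] excludes. *)
Definition state_value (t : nat) (x : option (option nat)) : int :=
  match x with
  | Some None => (2 * t + 1)%N%:Z
  | Some (Some k) => (2 * k)%N%:Z
  | None => 0
  end.

Definition cell_value (S : dotted) (t : nat) (c : cell) : int :=
  state_value t S.[? cell_box c]%fmap.

Lemma box_cellK b : cell_box (box_cell b) = b.
Proof. by case: b. Qed.

Lemma cell_boxK A c : cells A c -> box_cell (cell_box c) = c.
Proof.
case: c => c1 c2; rewrite /cells /box_cell /= => /and3P[c1p c2p _].
by rewrite !gez0_abs.
Qed.

Lemma cells_box A b : cells A (box_cell b) = (b \in A).
Proof. by rewrite /cells box_cellK. Qed.

Lemma neighbours_box b c : neighbours (box_cell b) (box_cell c) = adjacent b c.
Proof.
by case: b c => [b1 b2] [c1 c2]; rewrite /neighbours /adjacent /=; lia.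
Qed.

Lemma adjacent_irrefl b : adjacent b b = false.
Proof. by case: b => b1 b2; rewrite /adjacent /=; lia. Qed.

(** This makes the condition on components local: a path from [b] to another box of its component
    starts with a neighbour of [b]. *)
Lemma in_large_componentP (A : {fset box}) b :
  reflect (b \in A /\ exists2 c, c \in A & adjacent b c)
          (in_large_component A b).
Proof.
apply: (iffP existsP) => [[a /andP[/eqP <- gt1]]|[bA [c cA bc]]].
  split; first exact: valP.
  have: (0 < #|component a :\ a|)%N.
    by move: gt1; rewrite (cardsD1 a) inE connect0 ltnS.
  rewrite card_gt0 => /set0Pn[d]; rewrite !inE => /andP[da /connectP[p]].
  case: p => [_ dE|e p /= /andP[ae _] _]; first by rewrite dE eqxx in da.
  by exists (val e) => //; apply: valP.
exists [` bA]%fset; rewrite eqxx /=.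
have -> : (1 < #|component [` bA]%fset|)%N = true; last by [].
rewrite (cardsD1 [` bA]%fset) inE connect0 ltnS card_gt0.
apply/set0Pn; exists [` cA]%fset; rewrite !inE; apply/andP; split.
  by apply/eqP=> /(congr1 val) /= E; rewrite E adjacent_irrefl in bc.
by apply: connect1.
Qed.

Lemma domf_switch S j : domf (switch S j) = domf S.
Proof. by []. Qed.

Lemma fnd_switch S j b : (switch S j).[? b]%fmap =
  if in_large_component (bullets_and j S) b
  then omap (fun x => if x is None then Some j else None) S.[? b]%fmap
  else S.[? b]%fmap.
Proof.
have [bS|bS] := boolP (b \in domf S); last first.
  by rewrite !not_fnd //; case: ifP.
have bS' : b \in domf (switch S j) by [].
rewrite (in_fnd bS') (in_fnd bS) ffunE /=; case: ifP => _; last first.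
  by congr (Some (S _)); apply: val_inj.
by rewrite (_ : [` bS'] = [` bS])%fset //; apply: val_inj.
Qed.

Lemma in_bullets_and j S b : (b \in bullets_and j S) =
  (S.[? b]%fmap == Some None) || (S.[? b]%fmap == Some (Some j)).
Proof.
rewrite !inE /=; have [bS //|bS] := boolP (b \in domf S).
by rewrite not_fnd.
Qed.

Lemma bullet_value S t c :
  (cell_value S t c == 1 + (2 * t)%N%:Z) = (S.[? cell_box c]%fmap == Some None).
Proof.
rewrite /cell_value; case: (S.[? _]%fmap) => [[k|]|] /=.
- by transitivity false => //; lia.
- by rewrite eqxx; lia.
- by transitivity false => //; lia.
Qed.

Lemma label_value S t c :
  (cell_value S t c == 1 + (2 * t)%N%:Z + 1) =
  (S.[? cell_box c]%fmap == Some (Some t.+1)).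
Proof.
rewrite /cell_value; case: (S.[? _]%fmap) => [[k|]|] /=.
- by apply/eqP/eqP => [E|[->]]; [congr (Some (Some _))|]; lia.
- by transitivity false => //; lia.
- by transitivity false => //; lia.
Qed.

(** Equal values never sit on neighbours in an increasing filling, so a neighbour among bullets and
    labels [t.+1] must be of the opposite kind. *)
Lemma large_component_next_to S t c x y :
  let b := 1 + (2 * t)%N%:Z in
  increasing_on (cells (domf S)) (cell_value S t) ->
  cells (domf S) c -> cell_value S t c = x ->
  (x = b /\ y = b + 1) \/ (x = b + 1 /\ y = b) ->
  in_large_component (bullets_and t.+1 S) (cell_box c) <->
  next_to (cells (domf S)) (cell_value S t) c y.
Proof.
move=> b inc Dc wc xy.
have inA d : (cell_box d \in bullets_and t.+1 S) =
    (cell_value S t d == b) || (cell_value S t d == b + 1).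
  by rewrite in_bullets_and bullet_value label_value.
have cA : cell_box c \in bullets_and t.+1 S.
  by rewrite inA wc; case: xy => -[-> _]; rewrite eqxx ?orbT.
split=> [/in_large_componentP[_ [e eA ce]]|[d [Dd nb wd]]].
  exists (box_cell e).
  have De : cells (domf S) (box_cell e).
    by rewrite cells_box -fndSome; move: eA; rewrite in_bullets_and;
      case: (S.[? e]%fmap).
  have nb : neighbours c (box_cell e).
    by rewrite -(cell_boxK Dc) neighbours_box.
  split=> //; have := neighbours_neq inc Dc De nb; rewrite wc.
  move: eA; rewrite -{1}(box_cellK e) inA.
  by case: xy => -[-> ->]; case/orP => /eqP ->; rewrite ?eqxx.
apply/in_large_componentP; split=> //; exists (cell_box d).
  by rewrite inA wd; case: xy => -[_ ->]; rewrite eqxx ?orbT.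
by rewrite -neighbours_box (cell_boxK Dc) (cell_boxK Dd).
Qed.

Lemma switch_slide_step S t :
  increasing_on (cells (domf S)) (cell_value S t) ->
  slide_step (cells (domf S)) (cell_value S t)
    (cell_value (switch S t.+1) t.+1) (1 + (2 * t)%N%:Z).
Proof.
move=> inc; set b := 1 + _.
have b2 : b + 2 = (2 * t.+1 + 1)%N%:Z by rewrite /b; lia.
have b1 : b + 1 = (2 * t.+1)%N%:Z by rewrite /b; lia.
split=> c Dc.
- rewrite bullet_value label_value => nb nl.
  rewrite /cell_value fnd_switch.
  have /negPf-> : ~~ in_large_component (bullets_and t.+1 S) (cell_box c).
    apply/negP=> /in_large_componentP[].
    by rewrite in_bullets_and (negPf nb) (negPf nl).
  by case: (S.[? _]%fmap) nb => [[k|]|].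
- move=> wc;
    have lc := @large_component_next_to S t c b (b + 1) inc Dc wc (or_introl
      (conj erefl erefl)).
  move/eqP: (wc); rewrite bullet_value => /eqP Sc.
  case: (boolP (in_large_component (bullets_and t.+1 S) (cell_box c))) => lg.
    left; split; last exact/lc.
    by rewrite /cell_value fnd_switch lg Sc.
  (* A bullet that is not switched stays a bullet; its value rises to [b + 2] only because [t]
     becomes [t.+1]. *)
  right; split; last by move/lc; apply/negP.
  by rewrite /cell_value fnd_switch (negPf lg) Sc.
- move=> wc;
    have lc := @large_component_next_to S t c (b + 1) b inc Dc wc (or_intror
      (conj erefl erefl)).
  move/eqP: (wc); rewrite label_value => /eqP Sc.
  case: (boolP (in_large_component (bullets_and t.+1 S) (cell_box c))) => lg.
    left; split; last exact/lc.
    by rewrite /cell_value fnd_switch lg Sc.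
  right; split; last by move/lc; apply/negP.
  by rewrite /cell_value fnd_switch (negPf lg) Sc.
(* The value [b + 2] is odd and differs from the current bullet value, so neither a label nor a
   bullet carries it. *)
- rewrite b2 /cell_value; case: (S.[? _]%fmap) => [[k|]|] /=; clear; lia.
Qed.

End Dotted.

(** * Partitions and order ideals *)

Section Shapes.
Local Open Scope fset_scope.

Definition nw (b c : box) : bool := (b.1 <= c.1) && (b.2 <= c.2).

Definition down_closed (A : {fset box}) : Prop :=
  forall b c, c \in A -> nw b c -> b \in A.

Lemma in_young s b : (b \in young s) = (b.2 < nth 0 s b.1).
Proof.
case: b => i j; rewrite /young !inE /=; apply/allpairsPdep/idP => /=.
  move=> [i' [j' [_]]]; rewrite !mem_iota add0n => /andP[_ lt] [-> ->].
  exact: lt.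
move=> lt; exists i, j; split=> //; last by rewrite mem_iota.
rewrite mem_iota /= add0n; apply: contraLR lt; rewrite -!leqNgt => le.
by rewrite nth_default.
Qed.

Lemma partition_nth s i i' : is_partition s -> i <= i' -> nth 0 s i' <= nth 0 s
  i.
Proof.
move=> /andP[srt _] le_i.
have [lt|ge] := ltnP i' (size s); last by rewrite (nth_default _ ge).
have tr : transitive geq by move=> x y z /= xy yz; apply: leq_trans yz xy.
have rf : reflexive geq by move=> x /=.
by apply: (sorted_leq_nth tr rf 0 srt) => //; rewrite inE //;
  apply: leq_ltn_trans lt.
Qed.

Lemma young_down_closed s : is_partition s -> down_closed (young s).
Proof.
move=> ps b c; rewrite !in_young => lt /andP[le1 le2].
apply: leq_ltn_trans le2 _; apply: leq_trans lt _; exact: partition_nth.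
Qed.

Lemma diagram_down_closed A : is_diagram A -> down_closed A.
Proof. by case=> s ps ->; apply: young_down_closed. Qed.

Lemma fset_box_bounded (A : {fset box}) :
  exists M, forall b, b \in A -> b.1 < M /\ b.2 < M.
Proof.
exists (\max_(b : A) (maxn (val b).1 (val b).2)).+1 => b bA.
have := @leq_bigmax A (fun b => maxn (val b).1 (val b).2) [` bA].
by rewrite geq_max !ltnS => /andP.
Qed.

(** The length of a row is its first missing column, which exists by finiteness. Cutting at the
    first row that misses column 0 keeps zero parts out of the partition. *)
Lemma down_closed_diagram A : down_closed A -> is_diagram A.
Proof.
move=> dc; have [M bM] := fset_box_bounded A.
have exr i : exists j, (i, j) \notin A.
  by exists M; apply/negP=> /bM[_]; rewrite ltnn.
have exN : exists i, (i, 0) \notin A.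
  by exists M; apply/negP=> /bM[]; rewrite ltnn.
pose r i := ex_minn (exr i); pose N := ex_minn exN.
have rP i j : (j < r i) = ((i, j) \in A).
  rewrite /r; case: ex_minnP => m nm minm.
  apply/idP/idP => [lt|inA]; first by apply: contraLR lt => /minm;
    rewrite -leqNgt.
  rewrite ltnNge; apply: contra nm => le; apply: dc inA _.
  by rewrite /nw /= leqnn le.
have NP i : (i < N) = ((i, 0) \in A).
  rewrite /N; case: ex_minnP => m nm minm.
  apply/idP/idP => [lt|inA]; first by apply: contraLR lt => /minm;
    rewrite -leqNgt.
  rewrite ltnNge; apply: contra nm => le; apply: dc inA _.
  by rewrite /nw /= leqnn le.
exists (mkseq r N).
  apply/andP; split; last first.
    apply/mapP=> -[i]; rewrite mem_iota add0n /= NP -rP => lt E.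
    by rewrite -E in lt.
  rewrite /mkseq sorted_map; apply: sub_sorted (iota_sorted 0 N) => i i' le /=.
  have [//|lt] := leqP (r i') (r i).
  have : (i, r i) \in A.
    by apply: (dc _ (i', r i)); [rewrite -rP | rewrite /nw /= le leqnn].
  by rewrite -rP ltnn.
apply/fsetP=> -[i j]; rewrite in_young /=.
have [lt|ge] := ltnP i N; first by rewrite nth_mkseq // rP.
rewrite nth_default ?size_mkseq // ltn0; apply/negP=> inA.
have : (i, 0) \in A by apply: dc inA _; rewrite /nw /= leqnn.
by rewrite -NP ltnNge ge.
Qed.

(** If a removed corner [b] were weakly northwest of a remaining box, then removing [b] alone would
    already fail to leave a diagram. *)
Lemma corners_removed_down_closed (A X : {fset box}) :
  down_closed A -> slide_corners A X -> down_closed (A `\` X).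
Proof.
move=> dcA [_ crn] b c; rewrite !inE => /andP[cX cA] bc.
rewrite (dcA _ _ cA bc) andbT; apply/negP=> bX.
have [_ /diagram_down_closed dc] := crn _ bX.
have := dc b c; rewrite !inE cA eqxx /= andbT => /(_ _ bc).
suff -> : c != b by move/(_ isT).
by apply: contraNneq cX => ->.
Qed.

End Shapes.

(** * Chains and LIS *)

Section Tableaux.
Local Open Scope fset_scope.
Local Open Scope fmap_scope.

(** Rows and columns suffice because the bend [(i, j')] of the path from one box to the other also
    lies in the skew shape. *)
Lemma tableau_increasing nu lam T b c k k' : increasing_tableau nu lam T ->
  T.[? b] = Some k -> T.[? c] = Some k' -> nw b c -> b != c -> k < k'.
Proof.
case=> pnu plam _ shp _ row col Tb Tc bc ne.
case: b c bc ne Tb Tc => [i j] [i' j'] /andP[/= le1 le2];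
  rewrite xpair_eqE => ne Tb Tc.
have inT b x : T.[? b] = Some x -> b \in young nu `\` young lam.
  by rewrite -shp -fndSome => ->.
have: (i, j') \in domf T.
  rewrite shp; move: (inT _ _ Tb) (inT _ _ Tc);
    rewrite !in_fsetD => /andP[nb _] /andP[_ cn].
  apply/andP; split.
    by apply: contra nb => ib; apply: (young_down_closed plam ib);
      rewrite /nw /= leqnn.
  by apply: (young_down_closed pnu cn); rewrite /nw /= leqnn andbT.
move=> eT; have [x Te] : exists x, T.[? (i, j')] = Some x.
  by exists T.[eT]; rewrite in_fnd.
have le_k : k <= x.
  have [lt|ge] := ltnP j j'; first exact: ltnW (row _ _ _ _ _ Tb Te lt).
  have E : j = j' by apply/eqP; rewrite eqn_leq le2.
  by move: Te; rewrite -E Tb => -[->].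
have [lt|ge] := ltnP i i';
  first exact: leq_ltn_trans le_k (col _ _ _ _ _ Te Tc lt).
have E : i = i' by apply/eqP; rewrite eqn_leq le1.
apply: row Tb _ _; first by rewrite E; exact: Tc.
by rewrite ltn_neqAle le2 andbT; move: ne; rewrite E eqxx.
Qed.

Definition label (T : tableau) (b : box) : nat := odflt 0 T.[? b].

Definition box_step (T : tableau) (b c : box) : bool :=
  [&& c.1 <= b.1, b.2 < c.2 & label T b < label T c].

Definition chain (T : tableau) (s : seq box) : bool :=
  all (fun b => b \in domf T) s && sorted (box_step T) s.

Lemma reading_wordE T :
  reading_word T = map (label T) (sort reading_before (domf T)).
Proof.
rewrite /reading_word; set L := sort _ _.
have: {subset L <= domf T} by move=> b; rewrite mem_sort.
elim: L => //= b L IH sub; rewrite IH; last by move=> c cL; apply: sub;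
  rewrite inE cL orbT.
by rewrite /label; have bT := sub b (mem_head _ _); rewrite (in_fnd bT).
Qed.

Lemma reading_before_total : total reading_before.
Proof. by move=> [a b] [c d]; rewrite /reading_before /=; lia. Qed.
Lemma reading_before_trans : transitive reading_before.
Proof. by move=> [a b] [c d] [e f]; rewrite /reading_before /=; lia. Qed.
Lemma reading_before_anti : antisymmetric reading_before.
Proof.
by move=> [a b] [c d]; rewrite /reading_before /= => H; congr pair; lia.
Qed.

Lemma LIS_chain nu lam T : increasing_tableau nu lam T ->
  exists2 s, chain T s & size s = LIS T.
Proof.
move=> hT; rewrite /LIS; set w := reading_word T.
(* The empty selection shows that the maximum ranges over a nonempty set and is therefore
   attained. *)
pose m0 : (size w).-tuple bool := [tuple of nseq (size w) false].
have P0 : sorted ltn (mask m0 w) by rewrite /= mask_false.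
pose A := [pred m : (size w).-tuple bool | sorted ltn (mask m w)].
have A0 : 0 < #|A| by apply/card_gt0P; exists m0.
have [m Pm ->] :=
  eq_bigmax_cond (fun m : (size w).-tuple bool => size (mask m w)) A0.
rewrite inE in Pm.
pose s := mask m (sort reading_before (domf T)).
have Em : mask m w = map (label T) s by rewrite /s map_mask -reading_wordE.
exists s; last by rewrite Em size_map.
have sub : subseq s (sort reading_before (domf T)) by apply: mask_subseq.
have inT b : b \in s -> b \in domf T.
  by move=> /(mem_subseq sub); rewrite mem_sort.
apply/andP; split; first exact/allP.
have srt1 : sorted reading_before s.
  apply: (subseq_sorted reading_before_trans sub).
  exact: (sort_sorted reading_before_total).
move: Pm; rewrite Em sorted_map => srt2.
have srt : sorted (fun b c => reading_before b c && (label T b < label T c)) s.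
  by have := sorted_relI reading_before (relpre (label T) ltn) s;
    rewrite srt1 srt2.
apply: (sub_in_sorted (P := mem s)) srt; last exact/allP.
move=> b c /inT bT /inT cT /andP[rb lt]; rewrite /box_step lt andbT.
have [Tb Tc] : T.[? b] = Some (label T b) /\ T.[? c] = Some (label T c).
  by rewrite /label (in_fnd bT) (in_fnd cT).
(* A box weakly northwest of [b] has no larger label. So a later box in reading order with a larger
   label is weakly above and strictly to the right. *)
have ncb : ~~ nw c b.
  apply/negP=> cb; have := tableau_increasing hT Tc Tb cb.
  by case: eqP => [E|_ /(_ isT)]; [rewrite E ltnn in lt | rewrite ltnNge ltnW].
by move: rb ncb; rewrite /reading_before /nw; lia.
Qed.

(** A chain is listed in reading order without repetition, so it is a filter of the sorted domain
    and hence a mask of the reading word. *)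
Lemma chain_LIS T s : chain T s -> size s <= LIS T.
Proof.
case/andP=> in_s ch_s; set L := sort reading_before (domf T).
have E : s = filter (mem s) L.
  apply: (sorted_eq reading_before_trans reading_before_anti).
  - apply: sub_sorted ch_s => b c /and3P[le1 lt2 _].
    by move: le1 lt2; rewrite /reading_before; clear; lia.
  - apply: (sorted_filter reading_before_trans).
    exact: (sort_sorted reading_before_total).
  apply: uniq_perm; last 1 first.
  - move=> b; rewrite mem_filter mem_sort; apply/idP/andP => [bs|[]//].
    by split=> //; apply: (allP in_s).
  - apply: (sorted_uniq _ _ ch_s) => [y x z|x]; rewrite /box_step; lia.
  - by rewrite filter_uniq // sort_uniq fset_uniq.
have : subseq s L by rewrite E filter_subseq.
case/subseqP=> m sm Es.
have szw : size m = size (reading_word T) by rewrite reading_wordE size_map.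
have Em : mask m (reading_word T) = map (label T) s.
  by rewrite reading_wordE -/L -map_mask -Es.
have szm : size m == size (reading_word T) by apply/eqP.
rewrite /LIS; apply: leq_trans (leq_bigmax_cond (Tuple szm) _);
  rewrite /= Em ?size_map //.
rewrite sorted_map; apply: sub_sorted ch_s => b c /and3P[_ _].
by [].
Qed.

End Tableaux.

(** * Slides of tableaux *)

Section Values.
Local Open Scope ring_scope.
Import Order.TTheory GRing.Theory Num.Theory.

Definition attains (D : pred cell) (w : cell -> int) (x : int) : Prop :=
  exists2 c, D c & w c = x.

(** This shows that no label is lost or created: when a cell loses [b + 1], the neighbouring bullet
    takes it over, and conversely. *)
Lemma slide_step_attains D w w' b x : slide_step D w w' b ->
  x != b -> x != b + 2 -> attains D w x <-> attains D w' x.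
Proof.
move=> st xb xb2; have [other bullet label gap] := st.
split=> -[c Dc wc].
  have [E|ne] := eqVneq x (b + 1); last by exists c; rewrite ?other ?wc.
  rewrite E in wc *; case: (label _ Dc wc) => [[_ [d [Dd nb wd]]]|[w'c _]].
    rewrite neighbours_sym in nb; exists d => //.
    by case: (slide_step_swap st Dd Dc nb wd wc).
  by exists c.
have [E|ne] := eqVneq (w c) b.
  case: (bullet _ Dc E) => -[w'c]; last by rewrite -wc w'c eqxx in xb2.
  by case=> d [Dd _ wd] ; exists d; rewrite // wd -w'c.
have [E|ne'] := eqVneq (w c) (b + 1).
  case: (label _ Dc E) => -[w'c _]; first by rewrite -wc w'c eqxx in xb2.
  by exists c; rewrite // E -w'c.
by exists c; rewrite // -(other c).
Qed.

End Values.

(** * The successive states of one slide *)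

Section Slide.
Local Open Scope ring_scope.
Import Order.TTheory GRing.Theory Num.Theory.

Definition slide_state (S : dotted) (t : nat) : dotted :=
  foldl switch S (iota 1 t).

Lemma slide_stateS S t : slide_state S t.+1 = switch (slide_state S t) t.+1.
Proof. by rewrite /slide_state -(addn1 t) iotaD foldl_cat /= addnC. Qed.

Lemma domf_slide_state S t : domf (slide_state S t) = domf S.
Proof. by elim: t => // t IH; rewrite slide_stateS domf_switch. Qed.

Definition slide_value (S : dotted) (t : nat) : cell -> int :=
  cell_value (slide_state S t) t.

(** Both claims go through one induction: a switch is a slide step only on an increasing filling,
    and a slide step keeps the filling increasing. *)
Lemma slide_value_step_inc S t : convex (cells (domf S)) ->
  increasing_on (cells (domf S)) (slide_value S 0) ->
  increasing_on (cells (domf S)) (slide_value S t) /\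
  slide_step (cells (domf S)) (slide_value S t) (slide_value S t.+1)
    (1 + (2 * t)%N%:Z).
Proof.
move=> cvx inc.
have step u : increasing_on (cells (domf S)) (slide_value S u) ->
    slide_step (cells (domf S)) (slide_value S u) (slide_value S u.+1)
      (1 + (2 * u)%N%:Z).
  move=> incu; have := @switch_slide_step (slide_state S u) u.
  by rewrite domf_slide_state -slide_stateS; apply.
elim: t => [|t [IH st]]; first by split; last exact: step.
have inc' := slide_step_increasing cvx IH st.
by split; last exact: step.
Qed.

Lemma slide_value_attains S t k : convex (cells (domf S)) ->
  increasing_on (cells (domf S)) (slide_value S 0) ->
  attains (cells (domf S)) (slide_value S 0) (2 * k)%N%:Z <->
  attains (cells (domf S)) (slide_value S t) (2 * k)%N%:Z.
Proof.
move=> cvx inc; elim: t => // t IH; rewrite IH.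
have [_ st] := slide_value_step_inc t cvx inc.
by apply: slide_step_attains st _ _; clear; lia.
Qed.

Lemma slide_value_label S t k : attains (cells (domf S)) (slide_value S t) (2 *
  k)%N%:Z
  <-> exists b, (slide_state S t).[? b]%fmap = Some (Some k).
Proof.
split=> [[c Dc]|[b Sb]].
  have: cell_box c \in domf (slide_state S t).
    by rewrite domf_slide_state; case/and3P: Dc.
  rewrite /slide_value /cell_value -fndSome.
  case E: (_.[? _]%fmap) => [[k'|]|] //= _ H; last by exfalso; move: H; clear;
    lia.
  by exists (cell_box c); rewrite E; congr (Some (Some _)); move: H; clear; lia.
exists (box_cell b);
  first by rewrite cells_box -(domf_slide_state S t) -fndSome Sb.
by rewrite /slide_value /cell_value box_cellK Sb.
Qed.

Definition labels_of (S : dotted) (U : tableau) : Prop :=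
  forall b k, U.[? b]%fmap = Some k <-> S.[? b]%fmap = Some (Some k).

(** The excluded value is that of the bullets. As an inequation it serves both ends of the slide: it
    becomes a lower bound in the first state and an upper bound in the last. *)
Lemma chain_cells S U t s : labels_of S U -> chain U s ->
  all (fun c => cells (domf S) c && (cell_value S t c != (2 * t + 1)%N%:Z))
    (map box_cell s) /\ sorted (ne_step (cell_value S t)) (map box_cell s).
Proof.
move=> lab /andP[in_s ch_s].
have val b : b \in s -> S.[? b]%fmap = Some (Some (label U b)).
  by move=> /(allP in_s) bU; apply/lab; rewrite /label (in_fnd bU).
split.
  rewrite all_map; apply/allP=> b bs /=.
  rewrite cells_box -fndSome /cell_value box_cellK (val _ bs) /=; clear; lia.
rewrite sorted_map; apply: (sub_in_sorted (P := mem s)) ch_s; last exact/allP.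
move=> b c bs cs /and3P[le lt ltl].
rewrite /ne_step /relpre /= /cell_value !box_cellK (val _ bs) (val _ cs) /=.
by move: le lt ltl; clear; lia.
Qed.

Lemma cells_chain S U t s : labels_of S U ->
  all (fun c => cells (domf S) c && (cell_value S t c != (2 * t + 1)%N%:Z)) s ->
  sorted (ne_step (cell_value S t)) s -> chain U (map cell_box s).
Proof.
move=> lab in_s ch_s.
have val c : c \in s -> U.[? cell_box c]%fmap = Some (label U (cell_box c)) /\
     S.[? cell_box c]%fmap = Some (Some (label U (cell_box c))).
  move=> /(allP in_s) /andP[/and3P[_ _]]; rewrite -fndSome /cell_value.
  case E: (S.[? _]%fmap) => [[k|]|] //= _ H; last by rewrite eqxx in H.
  by have /lab := E; rewrite /label => ->.
apply/andP; split.
  by rewrite all_map; apply/allP=> c /val[cU _] /=; rewrite -fndSome cU.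
rewrite sorted_map; apply: (sub_in_sorted (P := mem s)) ch_s; last exact/allP.
move=> c d cs ds; rewrite /ne_step /box_step /relpre /= /cell_value.
rewrite (val _ cs).2 (val _ ds).2 /=.
have := allP in_s _ cs; have := allP in_s _ ds; rewrite /cells; clear; lia.
Qed.

End Slide.

(** * Placing and deleting bullets *)

Section Bullets.
Local Open Scope fset_scope.
Local Open Scope fmap_scope.

Lemma fnd_put_bullets X T b : (put_bullets X T).[? b] =
  if b \in X then Some None else omap Some T.[? b].
Proof.
have [bS|bS] := boolP (b \in domf (put_bullets X T)); last first.
  move: (bS); rewrite not_fnd //= in_fsetU negb_or => /andP[/negPf-> bT].
  by rewrite not_fnd.
rewrite (in_fnd bS) ffunE /=; case: ifP => // bX.
by move: bS; rewrite /= in_fsetU bX /= => bT; rewrite (in_fnd bT).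
Qed.

Lemma delete_bullets_labels S : labels_of S (delete_bullets S).
Proof.
move=> b k.
have [bL|bL] := boolP (b \in labelled_boxes S).
  have bL' : b \in domf (delete_bullets S) by [].
  rewrite (in_fnd bL') ffunE /=.
  move: bL; rewrite !inE /= -fndSome; case: (S.[? b]) => [[x|]|] //= _.
  by split=> -[->].
have -> : (delete_bullets S).[? b] = None by rewrite not_fnd.
split=> // Sb; move: bL; rewrite !inE /= -fndSome Sb.
by [].
Qed.

Lemma max_labelE (T : tableau) q :
  (forall b k, T.[? b] = Some k -> 1 <= k <= q) ->
  (forall k, 1 <= k <= q -> exists b, T.[? b] = Some k) ->
  max_label T = q.
Proof.
move=> lq ex; apply/eqP; rewrite eqn_leq; apply/andP; split.
  apply/bigmax_leqP=> b _.
  by have := lq (val b) (T b); rewrite Some_fnd => /(_ erefl) /andP[].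
case: q lq ex => // q lq ex;
  have [b Tb] := ex q.+1 (ltac:(by rewrite /= leqnn)).
have bT : b \in domf T by rewrite -fndSome Tb.
have := @leq_bigmax (domf T) T [` bT]; rewrite -/(max_label T).
by move: Tb; rewrite (in_fnd bT) => -[->].
Qed.

End Bullets.

(** * Slides of increasing tableaux and rectification *)

Section Slides_of_tableaux.
Local Open Scope fset_scope.
Local Open Scope fmap_scope.

Lemma weakly_se_box b c : weakly_se (box_cell b) (box_cell c) = nw b c.
Proof. by case: b c => [b1 b2] [c1 c2]; rewrite /weakly_se /nw /=; lia. Qed.

Lemma box_cell_inj : injective box_cell.
Proof. exact: can_inj box_cellK. Qed.

Lemma cellsP A c : cells A c -> exists2 b, b \in A & c = box_cell b.
Proof.
by move=> Dc; exists (cell_box c); rewrite ?(cell_boxK Dc) //; case/and3P: Dc.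
Qed.

Lemma cells_convex (N L : {fset box}) :
  down_closed N -> down_closed L -> convex (cells (N `\` L)).
Proof.
move=> dN dL a e c /cellsP[b bA ->] /cellsP[d dA ->] be ed.
have Ee : e = box_cell (cell_box e).
  move: be; case: (e) => e1 e2;
    rewrite /weakly_se /box_cell /= => /andP[le1 le2].
  have [p1 p2] : ((0 <= e1) /\ (0 <= e2))%R by clear -le1 le2; lia.
  by rewrite !gez0_abs.
rewrite Ee !weakly_se_box cells_box in be ed *.
move: bA dA; rewrite !in_fsetD => /andP[bL _] /andP[_ dN'].
by rewrite (dN _ _ dN' ed) andbT; apply: contra bL => eL; apply: dL eL be.
Qed.

Lemma slide_domain nu lam T X : increasing_tableau nu lam T ->
  slide_corners (young lam) X ->
  domf (put_bullets X T) = young nu `\` (young lam `\` X).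
Proof.
move=> [_ _ /fsubsetP sub shp _ _ _] [_ crn]; apply/fsetP=> b.
rewrite /= in_fsetU shp !in_fsetD.
have [bX|_] := boolP (b \in X); last by [].
by have [/sub ->] := crn _ bX.
Qed.

(** Bullets start with the value 1, below every label value. Two distinct corners are incomparable,
    and no box of [T] is weakly northwest of a corner. *)
Lemma put_bullets_increasing nu lam T X : increasing_tableau nu lam T ->
  slide_corners (young lam) X ->
  increasing_on (cells (domf (put_bullets X T))) (cell_value (put_bullets X T)
    0).
Proof.
move=> hT [_ crn] _ _ /cellsP[b bA ->] /cellsP[c cA ->].
have [pnu plam _ shp [q [lq _]] _ _] := hT.
rewrite weakly_se_box (inj_eq box_cell_inj) => bc ne.
rewrite /cell_value !box_cellK !fnd_put_bullets.
move: bA cA; rewrite /= !in_fsetU.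
have [bX|_] := boolP (b \in X); have [cX|_] := boolP (c \in X) => //= bT cT.
- have [_ /diagram_down_closed dc] := crn _ bX; have [cl _] := crn _ cX.
  have := dc b c; rewrite !in_fsetD1 cl eqxx eq_sym ne.
  by move/(_ isT bc).
- rewrite (in_fnd cT) /=; have := lq _ _ (in_fnd cT); lia.
- have [cl _] := crn _ cX; have: b \in young nu `\` young lam by rewrite -shp.
  by rewrite in_fsetD (young_down_closed plam cl bc).
- rewrite (in_fnd bT) (in_fnd cT) /=.
  have := tableau_increasing hT (in_fnd bT) (in_fnd cT) bc ne; lia.
Qed.

Lemma put_bullets_labels nu lam T X : increasing_tableau nu lam T ->
  slide_corners (young lam) X -> labels_of (put_bullets X T) T.
Proof.
move=> [_ _ _ shp _ _ _] [_ crn] b k; rewrite fnd_put_bullets.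
have [bX|bX] := boolP (b \in X); last by case: (T.[? b]) => [x|];
  split=> // -[->].
have [bl _] := crn _ bX; split=> // Tb.
have: b \in young nu `\` young lam by rewrite -shp -fndSome Tb.
by rewrite in_fsetD bl.
Qed.

Lemma slide_convex nu lam T X : increasing_tableau nu lam T ->
  slide_corners (young lam) X -> convex (cells (domf (put_bullets X T))).
Proof.
move=> hT hX; rewrite (slide_domain hT hX); have [pnu plam _ _ _ _ _] := hT.
apply: cells_convex; first exact: young_down_closed.
exact: corners_removed_down_closed (young_down_closed plam) hX.
Qed.

(** The number [q] of switches is the largest label. Even values are neither lost nor created, so
    the labels after the slide are again exactly [1..q]. *)
Lemma Kjdt_state nu lam T X : increasing_tableau nu lam T ->
  slide_corners (young lam) X ->
  exists q, let S := put_bullets X T in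
    [/\ Kjdt X T = delete_bullets (slide_state S q),
        (forall b k, T.[? b] = Some k -> 1 <= k <= q),
        (forall b k, (slide_state S q).[? b] = Some (Some k) -> 1 <= k <= q) &
        forall k, 1 <= k <= q ->
          exists b, (slide_state S q).[? b] = Some (Some k)].
Proof.
move=> hT hX; have [pnu plam sub shp [q [lq ex]] _ _] := hT.
have att k := slide_value_attains q k (slide_convex hT hX)
  (put_bullets_increasing hT hX).
have lab := put_bullets_labels hT hX.
exists q => S; split=> //.
- by rewrite /Kjdt (max_labelE lq ex).
- move=> b k Sb;
    have : exists b, (slide_state S q).[? b] = Some (Some k) by exists b.
  by move/slide_value_label/att/slide_value_label => [b' /lab /lq].
- move=> k /ex[b /lab Sb]; apply/slide_value_label/att/slide_value_label.
  by exists b.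
Qed.

Lemma Kjdt_increasing_tableau nu lam T X : increasing_tableau nu lam T ->
  slide_corners (young lam) X ->
  exists nu' lam', increasing_tableau nu' lam' (Kjdt X T) /\
    young lam' = young lam `\` X.
Proof.
move=> hT hX; have [pnu plam sub _ _ _ _] := hT.
have [q [-> _ lq ex]] := Kjdt_state hT hX.
set S := slide_state _ q in lq ex *; set L := young lam `\` X.
have dL : down_closed L.
  exact: corners_removed_down_closed (young_down_closed plam) hX.
have lab := @delete_bullets_labels S; set U := delete_bullets S in lab *.
have domS : domf S = young nu `\` L.
  by rewrite domf_slide_state (slide_domain hT hX).
have inU b k : U.[? b] = Some k -> b \in young nu `\` L.
  by move/lab => Sb; rewrite -domS -fndSome Sb.
have inc : increasing_on (cells (domf S)) (cell_value S q).
  rewrite domf_slide_state.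
  by case: (slide_value_step_inc q (slide_convex hT hX)
    (put_bullets_increasing hT hX)).
have incU b c k k' : U.[? b] = Some k -> U.[? c] = Some k' ->
    nw b c -> b != c -> k < k'.
  move=> Ub Uc bc ne.
  have := inc (box_cell b) (box_cell c).
  rewrite !cells_box weakly_se_box (inj_eq box_cell_inj) domS.
  move/(_ (inU _ _ Ub) (inU _ _ Uc) bc ne).
  move/lab: Ub => Sb; move/lab: Uc => Sc.
  by rewrite /cell_value !box_cellK Sb Sc /=; clear; lia.
(* The new outer shape is the smaller inner shape together with the labelled boxes. Final bullets
   carry [2q + 1], above every label, so none is weakly northwest of a labelled box, and deleting
   them leaves an order ideal. *)
have dN : down_closed (L `|` domf U).
  move=> b c; rewrite !in_fsetU => /orP[cL|cU] bc;
    first by rewrite (dL _ _ cL bc).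
  have [//|bL] := boolP (b \in L).
  have [k Uc] : exists k, U.[? c] = Some k by exists U.[cU]; rewrite in_fnd.
  have cA := inU _ _ Uc.
  have bA : b \in young nu `\` L.
    move: cA; rewrite in_fsetD => /andP[_ cN].
    by rewrite in_fsetD bL (young_down_closed pnu cN bc).
  have bS : b \in domf S by rewrite domS.
  case E: S.[? b] => [[k'|]|]; last by rewrite -fndSome E in bS.
    by move/lab: E => Ub; rewrite -fndSome Ub.
  have := inc (box_cell b) (box_cell c).
  rewrite !cells_box weakly_se_box (inj_eq box_cell_inj) domS.
  move/lab: Uc => Sc; move/(_ bA cA bc).
  have -> : b != c by apply: contra_eq_neq E => ->; rewrite Sc.
  rewrite /cell_value !box_cellK E Sc /= => /(_ isT).
  by have := lq _ _ Sc; clear; lia.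
have [nu' pnu' Enu] := down_closed_diagram dN.
have [lam' plam' Elam] := down_closed_diagram dL.
exists nu', lam'; split=> //; split=> //.
- by rewrite -Enu -Elam fsubsetUl.
- rewrite -Enu -Elam; apply/fsetP=> b; rewrite in_fsetD in_fsetU.
  have [bU|_] := boolP (b \in domf U); last by rewrite orbF andNb.
  have := inU _ _ (in_fnd bU); rewrite in_fsetD orbT andbT.
  by case/andP=> ->.
- exists q; split=> [b k /lab /lq //|k /ex[b /lab Ub]]; by exists b.
- move=> i j j' k k' U1 U2 lt; apply: incU U1 U2 _ _;
    first by rewrite /nw /= leqnn ltnW.
  by rewrite xpair_eqE eqxx /= neq_ltn lt.
- move=> i i' j k k' U1 U2 lt; apply: incU U1 U2 _ _;
    first by rewrite /nw /= leqnn ltnW.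
  by rewrite xpair_eqE eqxx andbT /= neq_ltn lt.
Qed.

(** Bullets carry the least value at the start and the greatest at the end. Hence chains of [T] are
    entirely high at first, and chains of the result entirely low at last, as [slides_chain] and its
    backward form require. *)
Lemma Kjdt_LIS nu lam T X : increasing_tableau nu lam T ->
  slide_corners (young lam) X -> LIS (Kjdt X T) = LIS T.
Proof.
move=> hT hX; have [nu' [lam' [hU _]]] := Kjdt_increasing_tableau hT hX.
have [q [EU lqT lqS _]] := Kjdt_state hT hX.
set S0 := put_bullets X T in EU lqS.
have cvx := slide_convex hT hX; have inc := put_bullets_increasing hT hX.
have labT := put_bullets_labels hT hX.
have labU := @delete_bullets_labels (slide_state S0 q); rewrite -EU in labU.
have st t : t < q -> slide_step (cells (domf S0)) (slide_value S0 t)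
    (slide_value S0 t.+1) (1 + (2 * t)%N%:Z)%R.
  by move=> _; case: (slide_value_step_inc t cvx inc).
have bot c : cells (domf S0) c -> (1 <= slide_value S0 0 c)%R.
  case/cellsP=> b bS ->; rewrite /slide_value /cell_value box_cellK.
  have: b \in domf (slide_state S0 0) by [].
  rewrite -fndSome; case E: (_.[? b]) => [[k|]|] //= _.
  by have /labT/lqT := E; clear; lia.
have top c : cells (domf S0) c -> (slide_value S0 q c <= 1 + (2 * q)%N%:Z)%R.
  case/cellsP=> b bS ->; rewrite /slide_value /cell_value box_cellK.
  have: b \in domf (slide_state S0 q) by rewrite domf_slide_state.
  rewrite -fndSome; case E: (_.[? b]) => [[k|]|] //= _; last by clear; lia.
  by have := lqS _ _ E; clear; lia.
apply/eqP; rewrite eqn_leq; apply/andP; split.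
  have [s ch_s <-] := LIS_chain hU.
  have [in_s' ch_s'] := chain_cells q labU ch_s.
  rewrite domf_slide_state in in_s'.
  have [|s' [Es' in_t ch_t]] := slides_chain_backward (w_ := slide_value S0)
    cvx inc st bot _ ch_s'.
    apply: sub_all in_s' => c /andP[Dc ne]; rewrite Dc /=.
    by move: (top _ Dc) ne; rewrite /slide_value;
      move: (cell_value _ _ _) => x; clear; lia.
  rewrite size_map in Es'; rewrite -Es' -(size_map cell_box).
  apply: chain_LIS; apply: (cells_chain (t := 0) labT) ch_t.
  by apply: sub_all in_t => c /andP[-> ]; rewrite /slide_value;
    move: (cell_value _ _ _) => x; clear; lia.
have [s ch_s <-] := LIS_chain hT.
have [in_s' ch_s'] := chain_cells 0 labT ch_s.
have [|s' [Es' in_t ch_t]] := slides_chain (w_ := slide_value S0) cvx inc st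
  top _ ch_s'.
  apply: sub_all in_s' => c /andP[Dc ne]; rewrite Dc /=.
  by move: (bot _ Dc) ne; rewrite /slide_value; move: (cell_value _ _ _) => x;
    clear; lia.
rewrite size_map in Es'; rewrite -Es' -(size_map cell_box).
apply: chain_LIS; apply: (cells_chain (t := q) labU) ch_t.
rewrite domf_slide_state.
by apply: sub_all in_t => c /andP[-> ]; rewrite /slide_value;
  move: (cell_value _ _ _) => x; clear; lia.
Qed.

(** The boxes of a chain lie in distinct columns, and no row is longer than the first; the first row
    is itself a chain. *)
Lemma straight_LIS mu T : increasing_tableau mu [::] T -> LIS T = nth 0 mu 0.
Proof.
move=> hT; have [pmu _ _ shp _ row _] := hT.
have inT b : (b \in domf T) = (b.2 < nth 0 mu b.1).
  by rewrite shp in_fsetD !in_young /= nth_nil.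
apply/eqP; rewrite eqn_leq; apply/andP; split.
  have [s /andP[in_s ch_s] <-] := LIS_chain hT.
  rewrite -(size_iota 0 (nth 0 mu 0)) -(size_map snd s).
  apply: uniq_leq_size.
    apply: (sorted_uniq ltn_trans ltnn); rewrite sorted_map.
    by apply: sub_sorted ch_s => b c /and3P[].
  move=> j /mapP[b /(allP in_s)]; rewrite inT mem_iota => lt ->.
  by apply: leq_trans lt _; apply: partition_nth.
pose s := [seq (0, j) | j <- iota 0 (nth 0 mu 0)].
have <- : size s = nth 0 mu 0 by rewrite size_map size_iota.
apply: chain_LIS; apply/andP; split.
  by apply/allP=> b /mapP[j]; rewrite mem_iota => lt ->; rewrite inT.
have srt := iota_ltn_sorted 0 (nth 0 mu 0).
rewrite sorted_map;
  apply: (sub_in_sorted (P := mem (iota 0 (nth 0 mu 0)))) srt; last exact/allP.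
move=> j j' ji j'i jj'.
have [lt lt'] : j < nth 0 mu 0 /\ j' < nth 0 mu 0.
  have : j \in iota 0 (nth 0 mu 0) := ji;
    have : j' \in iota 0 (nth 0 mu 0) := j'i.
  by rewrite !mem_iota.
apply/and3P; split=> //=.
have jT : (0, j) \in domf T by rewrite inT.
have jT' : (0, j') \in domf T by rewrite inT.
rewrite /label (in_fnd jT) (in_fnd jT') /=.
exact: row (in_fnd jT) (in_fnd jT') jj'.
Qed.

Lemma rectify_straight nu lam T Xs : increasing_tableau nu lam T ->
  rectification_order (young lam) Xs ->
  exists mu, increasing_tableau mu [::] (rectify Xs T) /\ nth 0 mu 0 = LIS T.
Proof.
elim: Xs nu lam T => [|X Xs IH] nu lam T hT /=.
  (* A partition has no zero part, so a nonempty one would contain the box [(0, 0)]. *)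
  move=> lam0; have lamE : lam = [::].
    case: lam hT lam0 => // x lam [_ /andP[_]];
      rewrite inE negb_or eq_sym => /andP[x0 _].
    move=> _ _ _ _ _ E;
      have : (0, 0) \in young (x :: lam) by rewrite in_young /= lt0n.
    by rewrite E.
  rewrite lamE in hT; exists nu; split=> //; by rewrite (straight_LIS hT).
move=> [hX ro]; have [nu' [lam' [hT' El]]] := Kjdt_increasing_tableau hT hX.
rewrite -El in ro; have [mu [h1 h2]] := IH _ _ _ hT' ro.
by exists mu; split=> //; rewrite h2 (Kjdt_LIS hT hX).
Qed.

End Slides_of_tableaux.

Theorem theorem6p1 (nu lam : seq nat) (T : tableau)
    (hT : increasing_tableau nu lam T) :
  (forall X : {fset box}, slide_corners (young lam) X ->
     LIS (Kjdt X T) = LIS T) /\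
  (forall Xs : seq {fset box}, rectification_order (young lam) Xs ->
     exists mu : seq nat,
       increasing_tableau mu [::] (rectify Xs T) /\ nth 0 mu 0 = LIS T).
Proof.
split=> [X hX|Xs]; first exact: Kjdt_LIS hT hX.
exact: rectify_straight hT.
Qed.
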